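(* Let $T = (T_1,\ldots,T_n) \in \mathcal{B}(\mathcal{H})^n$ be a pure commuting contractive tuple on a Hilbert space $\mathcal{H}$ and let $\Pi : H^2_n(\mathcal{E}) \to \mathcal{H}$ be a canonical representation of a closed $T$-invariant subspace $\mathcal{S} \subset \mathcal{H}$. If $\tilde{\mathcal{E}}$ is a Hilbert space and $\tilde{\Pi} : H^2_n(\tilde{\mathcal{E}}) \to \mathcal{H}$ is a partial isometry with $\mathcal{S} = \tilde{\Pi} H^2_n(\tilde{\mathcal{E}})$ and $\tilde{\Pi} M_{z_i} = T_i \tilde{\Pi}$ for $i=1,\ldots,n$, then there exists an isometry $V : \mathcal{E} \to \tilde{\mathcal{E}}$ such that $$\tilde{\Pi} = \Pi\,(I_{H^2_n} \otimes V^* ).$$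
   Context: All Hilbert spaces are complex; $\mathbb{N}$ contains $0$. A commuting tuple $T=(T_1,\ldots,T_n)$ of bounded operators on $\mathcal{H}$ is a contractive tuple (row contraction) if $P_T(I_{\mathcal{H}}) \le I_{\mathcal{H}}$, where $P_T(X) = \sum_{i=1}^n T_i X T_i^*$. A row contraction is pure if $P_T^m(I_{\mathcal{H}}) \to 0$ in the strong operator topology as $m\to\infty$. A subspace $\mathcal{S}$ is $T$-invariant if $T_i\mathcal{S}\subset\mathcal{S}$ for all $i$; the restriction $T|_{\mathcal{S}} = (T_1|_{\mathcal{S}},\ldots,T_n|_{\mathcal{S}})$ of a pure commuting row contraction to a closed invariant subspace is again a pure commuting row contraction. $H^2_n$ is the Drury-Arveson space, i.e. the reproducing kernel Hilbert space of analytic functions on the open unit ball $\mathbb{B}^n \subset \mathbb{C}^n$ with kernel $(1-\sum_{i=1}^n z_i\bar w_i)^{-1}$. For a Hilbert space $\mathcal{E}$, $H^2_n(\mathcal{E})$ is the $\mathcal{E}$-valued reproducing kernel Hilbert space with kernel $(1-\sum_{i=1}^n z_i\bar w_i)^{-1} I_{\mathcal{E}}$, identified with $H^2_n \otimes \mathcal{E}$; $M_{z_i}$ denotes multiplication by the $i$-th coordinate function on it. For a pure commuting row contraction $R=(R_1,\ldots,R_n)$ on a Hilbert space $\mathcal{K}$, an isometry $\Gamma : \mathcal{K} \to H^2_n(\mathcal{E})$ is a dilation of $R$ if $M_{z_i}^*\Gamma = \Gamma R_i^*$ for $i=1,\ldots,n$; it is minimal if $H^2_n(\mathcal{E}) =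 \overline{\mathrm{span}}\{z^{k}\Gamma h : k \in \mathbb{N}^n, h \in \mathcal{K}\}$. A canonical representation of a closed $T$-invariant subspace $\mathcal{S} \subset \mathcal{H}$ is a map of the form $\Pi = i_{\mathcal{S}} \circ \Pi_{\mathcal{S}}^* : H^2_n(\mathcal{E}) \to \mathcal{H}$, where $\Pi_{\mathcal{S}} : \mathcal{S} \to H^2_n(\mathcal{E})$ is a minimal dilation of $T|_{\mathcal{S}}$ and $i_{\mathcal{S}} : \mathcal{S} \to \mathcal{H}$ is the inclusion map. *)

(* Defs.v *)
From HB Require Import structures.
From mathcomp Require Import all_boot all_order all_algebra.
From mathcomp Require Import complex.
From mathcomp Require Import all_classical all_reals all_analysis.

Set Implicit Arguments.
Unset Strict Implicit.
Unset Printing Implicit Defensive.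

Import Order.TTheory GRing.Theory Num.Theory.
Import numFieldNormedType.Exports.

Local Open Scope classical_set_scope.
Local Open Scope ring_scope.
Local Open Scope complex_scope.

(* The inner product is linear in the first argument and conjugate-linear in
   the second one. *)
HB.mixin Record isHilbert (R : realType) V of CompleteNormedModule R[i] V := {
  inner : {dot V for (@Num.conj R[i])} ;
  inner_norm : forall x : V, inner x x = `|x| ^+ 2
}.

#[short(type="hilbertType")]
HB.structure Definition Hilbert (R : realType) :=
  {V of CompleteNormedModule R[i] V & isHilbert R V}.

Section Operators.
Context {R : realType}.
Implicit Types U V H : hilbertType R.

(* Meaningful for bounded linear A, for which the vector picked below exists
   (Riesz) and is unique. *)
Definition adjoint U V (A : U -> V) (y : V) : U :=
  xget 0 [set x | forall u, inner (A u) y = inner u x].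

Definition op_le H (A B : H -> H) : Prop :=
  forall x, inner (A x) x <= inner (B x) x.

(* For a linear map between normed spaces, continuity is boundedness; see
   [linear_bounded_continuous]. *)
Definition bounded_operator U V (A : U -> V) : Prop := linear A /\ continuous A.

Definition is_isometry U V (A : U -> V) : Prop :=
  linear A /\ forall x, `|A x| = `|x|.

Definition partial_isometry U V (A : U -> V) : Prop :=
  bounded_operator A /\
    (forall x, (forall y, A y = 0 -> inner x y = 0) -> `|A x| = `|x|).

Definition linear_span V (A : set V) : set V :=
  [set x | exists m (c : 'I_m -> R[i]) (v : 'I_m -> V),
     (forall i, A (v i)) /\ x = \sum_(i < m) c i *: v i].

Definition commuting n H (T : 'I_n -> H -> H) : Prop :=
  forall i j x, T i (T j x) = T j (T i x).

Definition PT n H (T : 'I_n -> H -> H) (X : H -> H) : H -> H :=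
  fun x => \sum_(i < n) T i (X (adjoint (T i) x)).

Definition row_contraction n H (T : 'I_n -> H -> H) : Prop :=
  op_le (PT T id) id.

Definition pure n H (T : 'I_n -> H -> H) : Prop :=
  forall x, iter m (PT T) id x @[m --> \oo] --> (0 : H).

End Operators.

Section ClosedSubspace.
Context {R : realType} (H : hilbertType R).

Record closed_subspace := ClosedSubspace {
  subspace_set :> set H ;
  subspace0 : subspace_set 0 ;
  subspaceD : forall x y,
    subspace_set x -> subspace_set y -> subspace_set (x + y) ;
  subspaceZ : forall (a : R[i]) x, subspace_set x -> subspace_set (a *: x) ;
  subspace_closed : closed subspace_set
}.

Definition subspace_pred (S : closed_subspace) : {pred H} :=
  fun x => x \in (S : set H).

Record subspace_type (S : closed_subspace) := SubspaceType {
  subspace_val : H ;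
  subspace_valP : subspace_val \in subspace_pred S
}.

End ClosedSubspace.

Section SubspaceHilbert.
Context {R : realType} {H : hilbertType R} (S : closed_subspace H).

Lemma subspace_submod_closed : submod_closed (subspace_pred S).
Proof.
split; first by rewrite /subspace_pred unfold_in inE; exact: subspace0.
move=> a x y; rewrite !unfold_in !inE => Sx Sy.
by apply: subspaceD => //; exact: subspaceZ.
Qed.

HB.instance Definition _ :=
  GRing.isSubmodClosed.Build _ _ (subspace_pred S) subspace_submod_closed.

HB.instance Definition _ := [isSub of subspace_type S for @subspace_val R H S].
HB.instance Definition _ := [Choice of subspace_type S by <:].
HB.instance Definition _ := [SubChoice_isSubZmodule of subspace_type S by <:].
HB.instance Definition _ := [SubZmodule_isSubLmodule of subspace_type S by <:].

Let norm_sub (x : subspace_type S) : R[i] := `|val x|.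

Let norm_subD x y : norm_sub (x + y) <= norm_sub x + norm_sub y.
Proof. exact: ler_normD. Qed.

Let norm_subZ (l : R[i]) x : norm_sub (l *: x) = `|l| * norm_sub x.
Proof. exact: normrZ. Qed.

Let norm_sub0 x : norm_sub x = 0 -> x = 0.
Proof. by move=> /eqP; rewrite normr_eq0 => /eqP x0; exact: val_inj. Qed.

HB.instance Definition _ := Lmodule_isNormed.Build R[i] (subspace_type S)
  norm_subD norm_subZ norm_sub0.

Let sub_complete (F : set_system (subspace_type S)) :
  ProperFilter F -> cauchy F -> cvg F.
Proof.
move=> FF /cauchy_ballP Fc.
have FFv : ProperFilter ((val : _ -> H) @ F) by exact: fmap_proper_filter.
have vc : cauchy ((val : _ -> H) @ F).
  apply/cauchy_ballP => e e0; have [[A B] /= [FA FB] AB] := Fc e e0.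
  exists (val @` A, val @` B) => /=.
    split.
      by apply: filterS FA => x Ax; exists x.
    by apply: filterS FB => x Bx; exists x.
  move=> [_ _] /= [[x Ax <-] [y By <-]].
  by have := AB (x, y) (conj Ax By); rewrite -!ball_normE.
have /cvg_ex[l vl] : cvg ((val : _ -> H) @ F) by exact: cauchy_cvg.
have Sl : (S : set H) l.
  apply: (@closed_cvg _ _ F _ val (S : set H) (@subspace_closed _ _ S) _ l vl).
  by apply: nearW => x; have := valP x; rewrite unfold_in inE.
have Sl' : l \in subspace_pred S by rewrite unfold_in inE.
apply/cvg_ex; exists (Sub l Sl' : subspace_type S).
apply/cvgrPdist_lt => e e0; move/cvgrPdist_lt : vl => /(_ e e0).
by apply: filterS => x.
Qed.

HB.instance Definition _ := Uniform_isComplete.Build (subspace_type S)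
  sub_complete.

Definition subspace_inner (x y : subspace_type S) : R[i] := inner (val x) (val y).

Let sub_inner_linear :
  bilinear_for *%R (@Num.conj R[i] \; *%R) subspace_inner.
Proof.
split=> [y|x] a u v; first exact: (linearPl (inner : {dot H for _})).
exact: (linearPr (inner : {dot H for _})).
Qed.

HB.instance Definition _ := bilinear_isBilinear.Build R[i]
  (subspace_type S) (subspace_type S) R[i] *%R (@Num.conj R[i] \; *%R)
  subspace_inner sub_inner_linear.

Let sub_inner_herm (x y : subspace_type S) :
  subspace_inner x y = (-1) ^+ false * Num.conj (subspace_inner y x).
Proof. exact: (@hermitian_subproof _ _ _ _ (inner : {dot H for _})). Qed.

HB.instance Definition _ := isHermitianSesquilinear.Build R[i]
  (subspace_type S) false (@Num.conj R[i]) subspace_inner sub_inner_herm.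

Let sub_inner_gt0 (x : subspace_type S) : x != 0 -> 0 < subspace_inner x x.
Proof.
move=> x0; apply: (@neq0_dnorm_gt0 _ _ _ (inner : {dot H for _})).
by apply: contra_neq x0 => x0; exact: val_inj.
Qed.

HB.instance Definition _ := isDotProduct.Build R[i]
  (subspace_type S) subspace_inner sub_inner_gt0.

Let sub_inner_norm (x : subspace_type S) : subspace_inner x x = `|x| ^+ 2.
Proof. exact: inner_norm. Qed.

HB.instance Definition _ := isHilbert.Build R (subspace_type S)
  sub_inner_norm.

End SubspaceHilbert.

Section Restriction.
Context {R : realType} {H : hilbertType R}.

Definition invariant_subspace n (T : 'I_n -> H -> H) (S : closed_subspace H) : Prop :=
  forall i, T i @` S `<=` S.

Definition inclusion (S : closed_subspace H) : subspace_type S -> H := val.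

(* The default value 0 is never used when S is invariant under T. *)
Definition restriction n (T : 'I_n -> H -> H) (S : closed_subspace H) :
    'I_n -> subspace_type S -> subspace_type S :=
  fun i x => insubd 0 (T i (val x)).

End Restriction.

Arguments inclusion {R H} S _.
Arguments restriction {R H n} T S _ _.

(* An E-valued reproducing kernel Hilbert space of functions on X with kernel
   k(z, w) I_E: a Hilbert space whose elements are (through the injective
   linear map rkhs_eval) functions from X to E, which contains k(., w) eta for
   all w and eta, and satisfies <f, k(., w) eta> = <f(w), eta>.  The kernel
   determines this space of functions and its inner product uniquely. *)
Record rkhs (R : realType) (X : Type) (k : X -> X -> R[i]) (E : hilbertType R) :=
  Rkhs {
    rkhs_space :> hilbertType R ;
    rkhs_eval : rkhs_space -> X -> E ;
    rkhs_evalP : forall (a : R[i]) f g z,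
      rkhs_eval (a *: f + g) z = a *: rkhs_eval f z + rkhs_eval g z ;
    rkhs_eval_inj : injective rkhs_eval ;
    rkhs_kernel : forall w eta, exists K : rkhs_space,
      (forall z, rkhs_eval K z = k z w *: eta) /\
      (forall f, inner f K = inner (rkhs_eval f w) eta)
  }.

Section Rkhs.
Context {R : realType} {X : Type} {k : X -> X -> R[i]}.

(* Multiplication by phi; meaningful when phi is a multiplier of F. *)
Definition multiplication (E : hilbertType R) (F : rkhs k E) (phi : X -> R[i])
    (f : F) : F :=
  xget 0 [set g : F | forall z, rkhs_eval g z = phi z *: rkhs_eval f z].

(* g is phi (x) eta when the E-valued space is identified with the tensor
   product of the scalar-valued one with E. *)
Definition is_elementary_tensor (E : hilbertType R) (F : rkhs k E)
    (phi : X -> R[i]) (eta : E) (g : F) : Prop :=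
  forall z, rkhs_eval g z = phi z *: eta.

Arguments is_elementary_tensor {E} F phi eta g.

(* I (x) A: the bounded operator mapping each phi (x) eta to phi (x) (A eta). *)
Definition id_tensor (E E' : hilbertType R) (F : rkhs k E) (F' : rkhs k E')
    (A : E -> E') : F -> F' :=
  xget (fun=> 0) [set W : F -> F' | bounded_operator W /\
    forall phi eta f, is_elementary_tensor F phi eta f ->
      is_elementary_tensor F' phi (A eta) (W f)].

End Rkhs.

Arguments multiplication {R X k E} F phi f.
Arguments is_elementary_tensor {R X k E} F phi eta g.
Arguments id_tensor {R X k E E'} F F' A _.

Section DruryArveson.
Context {R : realType}.

Definition unit_ball n := {z : 'rV[R[i]]_n | \sum_(i < n) `|z 0 i| ^+ 2 < 1}.

Definition coordinate n (i : 'I_n) (z : unit_ball n) : R[i] := val z 0 i.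

Definition drury_arveson_kernel n (z w : unit_ball n) : R[i] :=
  (1 - \sum_(i < n) coordinate i z * Num.conj (coordinate i w))^-1.

Definition drury_arveson n (E : hilbertType R) :=
  rkhs (@drury_arveson_kernel n) E.

Definition Mz n (E : hilbertType R) (F : drury_arveson n E) (i : 'I_n) :
    F -> F :=
  multiplication F (coordinate i).

Definition Mmonomial n (E : hilbertType R) (F : drury_arveson n E)
    (k : 'I_n -> nat) : F -> F :=
  multiplication F (fun z => \prod_(i < n) coordinate i z ^+ k i).

Arguments Mz {n E} F i.
Arguments Mmonomial {n E} F k.

Definition is_dilation n (K E : hilbertType R) (F : drury_arveson n E)
    (S : 'I_n -> K -> K) (Gamma : K -> F) : Prop :=
  is_isometry Gamma /\
  forall i x, adjoint (Mz F i) (Gamma x) = Gamma (adjoint (S i) x).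

Definition is_minimal n (K E : hilbertType R) (F : drury_arveson n E)
    (Gamma : K -> F) : Prop :=
  closure (linear_span [set g : F | exists k h, g = Mmonomial F k (Gamma h)]) = setT.

Definition canonical_representation n (H E : hilbertType R)
    (F : drury_arveson n E) (T : 'I_n -> H -> H) (S : closed_subspace H)
    (Pi : F -> H) : Prop :=
  exists PiS : subspace_type S -> F,
    [/\ is_dilation (restriction T S) PiS, is_minimal PiS &
        Pi = inclusion S \o adjoint PiS].

End DruryArveson.

Arguments Mz {R n E} F i.
Arguments Mmonomial {R n E} F k.

(* Main.v *)
(* Both [Pi_S : S -> H^2(E)] and the restriction of [Pit^*] to S are dilations
   of R = T|_S.  For a dilation G, put D x = (G x)(0).  The identity
   [sum_i M_i M_i^* + (projection on constants) = I] gives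
   [D^* D = I - sum_i R_i R_i^*], which does not depend on G, so there is an
   isometry V with V D = Dt, defined on all of E because minimality makes the
   range of D dense.  Since (G x)(w) = (G A x)(w) + D x with
   A = sum_i w_i R_i^* a strict contraction, G is determined by D, and
   (Gt x)(w) = V ((G x)(w)), that is, Gt = (I (x) V) G.  The claim is the adjoint
   of this equality. *)

Require Import Defs.
From HB Require Import structures.
From mathcomp Require Import all_boot all_order all_algebra.
From mathcomp Require Import complex.
From mathcomp Require Import all_classical all_reals all_analysis.
From mathcomp Require Import ring.

Set Implicit Arguments.
Unset Strict Implicit.
Unset Printing Implicit Defensive.

Import Order.TTheory GRing.Theory Num.Theory.
Import numFieldNormedType.Exports.

Local Open Scope classical_set_scope.
Local Open Scope ring_scope.
Local Open Scope complex_scope.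

(** * Hilbert space geometry *)

Section HilbertSpaces.
Context {R : realType}.
Implicit Types H U V W : hilbertType R.

Lemma innerDl H (x y z : H) : inner (x + y) z = inner x z + inner y z.
Proof. exact: linearDl. Qed.

Lemma innerDr H (x y z : H) : inner z (x + y) = inner z x + inner z y.
Proof. exact: linearDr. Qed.

Lemma innerNl H (x z : H) : inner (- x) z = - inner x z.
Proof. exact: linearNl. Qed.

Lemma innerNr H (x z : H) : inner z (- x) = - inner z x.
Proof. exact: linearNr. Qed.

Lemma innerBl H (x y z : H) : inner (x - y) z = inner x z - inner y z.
Proof. by rewrite innerDl innerNl. Qed.

Lemma innerBr H (x y z : H) : inner z (x - y) = inner z x - inner z y.
Proof. by rewrite innerDr innerNr. Qed.

Lemma innerZl H (a : R[i]) (x z : H) : inner (a *: x) z = a * inner x z.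
Proof. exact: linearZl_LR. Qed.

Lemma innerZr H (a : R[i]) (x z : H) : inner z (a *: x) = Num.conj a * inner z x.
Proof. exact: linearZr_LR. Qed.

Lemma inner0l H (z : H) : inner 0 z = 0.
Proof. exact: linear0l. Qed.

Lemma inner0r H (z : H) : inner z 0 = 0.
Proof. exact: linear0r. Qed.

Lemma inner_suml H I (r : seq I) (P : pred I) (E : I -> H) z :
  inner (\sum_(i <- r | P i) E i) z = \sum_(i <- r | P i) inner (E i) z.
Proof. exact: linear_sumlz. Qed.

Lemma inner_sumr H I (r : seq I) (P : pred I) (E : I -> H) z :
  inner z (\sum_(i <- r | P i) E i) = \sum_(i <- r | P i) inner z (E i).
Proof. exact: linear_sumr. Qed.

Lemma innerC H (x y : H) : inner x y = Num.conj (inner y x).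
Proof.
by rewrite (@hermitian_subproof _ _ _ _ (inner : {dot H for _})) expr0 mul1r.
Qed.

Lemma inner_eq0 H (x : H) : inner x x = 0 -> x = 0.
Proof. by rewrite inner_norm => /eqP; rewrite expf_eq0/= normr_eq0 => /eqP. Qed.

Lemma inner_ext H (x y : H) : (forall z, inner x z = inner y z) -> x = y.
Proof.
by move=> xy; apply/eqP; rewrite -subr_eq0; apply/eqP/inner_eq0;
  rewrite innerBl xy subrr.
Qed.

Lemma normB2 H (x y : H) :
  `|x - y| ^+ 2 = `|x| ^+ 2 + `|y| ^+ 2 - (inner x y + inner y x).
Proof.
by rewrite -!inner_norm innerBl !innerBr; ring.
Qed.

Lemma parallelogram H (x y : H) :
  `|x - y| ^+ 2 + `|x + y| ^+ 2 = (`|x| ^+ 2 + `|y| ^+ 2) *+ 2.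
Proof.
rewrite -{2}(opprK y) !normB2 normrN innerNl innerNr -opprD opprK mulr2n.
by rewrite addrACA addNr addr0.
Qed.

Lemma cauchy_schwarz H (x y : H) : `|inner x y| <= `|x| * `|y|.
Proof.
have [->|y0] := eqVneq y 0; first by rewrite inner0r !normr0 mulr0.
have ny : 0 < `|y| ^+ 2 by rewrite exprn_gt0// normr_gt0.
rewrite -(@ler_pXn2r _ 2)// ?nnegrE ?mulr_ge0 ?normr_ge0//.
rewrite exprMn -ler_pdivrMr//.
set c := inner x y; pose a := c / `|y| ^+ 2.
have : 0 <= `|x - a *: y| ^+ 2 by rewrite exprn_ge0.
rewrite normB2 innerZl innerZr normrZ exprMn (innerC y x) -/c -addrA.
have ra : Num.conj a = Num.conj c / `|y| ^+ 2.
  by rewrite rmorphM/= fmorphV/= [X in _ / X = _]geC0_conj ?exprn_ge0.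
have y2 : `|y| != 0 by rewrite normr_eq0.
have -> : `|a| ^+ 2 * `|y| ^+ 2 - (Num.conj a * c + a * Num.conj c) =
    - (`|c| ^+ 2 / `|y| ^+ 2).
  by rewrite !normCK ra /a; field.
by rewrite subr_ge0.
Qed.

End HilbertSpaces.

(** * Orthogonal projection onto a closed subspace *)

Section Projection.
Context {R : realType}.
Implicit Types H U V W : hilbertType R.

Lemma ler_of_sqr (K : numDomainType) (a b : K) :
  0 <= a -> 0 <= b -> a ^+ 2 <= b ^+ 2 -> a <= b.
Proof. by move=> a0 b0; rewrite ler_pXn2r. Qed.

Lemma exists_natSinv_lt (e : R[i]) :
  0 < e -> exists N, forall m, (N <= m)%N -> m.+1%:R^-1 < e.
Proof.
(* Positivity in [R[i]] forces the imaginary part to vanish, which reduces the claim to the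
   Archimedean property of [R]. *)
case: e => a b; rewrite ltcE /= => /andP[/eqP-> a0].
have [N _ NP] := near_infty_natSinv_lt (PosNum a0).
exists N => m /NP /=; rewrite -ltcR => /le_lt_trans; apply.
by rewrite -(rmorph_nat (real_complex R)) -fmorphV lexx.
Qed.

(** The order of [R[i]] is only partial, so the infimum of the squared distances is taken over their
    real parts. *)
Lemma almost_nearest_point H (L : set H) x (e : R[i]) : L 0 -> 0 < e ->
  exists2 u, L u & forall v, L v -> `|x - u| ^+ 2 <= `|x - v| ^+ 2 + e.
Proof.
move=> L0; case: e => a b; rewrite ltcE /= => /andP[/eqP-> a0].
pose E := [set r : R | exists2 u, L u & `|x - u| ^+ 2 = r%:C].
have sqE v : `|x - v| ^+ 2 = (complex.Re (`|x - v| ^+ 2))%:C.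
  by rewrite RRe_real// realX// normr_real.
have lE : lbound E 0.
  by move=> r [u _ ur]; rewrite -ler0c -ur exprn_ge0.
have hE : has_inf E.
  by split; [exists (complex.Re (`|x - 0| ^+ 2)), 0 | exists 0].
have [r [u Lu ur] rlt] := inf_adherent a0 hE.
exists u => // v Lv; rewrite ur (sqE v).
have : inf E <= complex.Re (`|x - v| ^+ 2) by apply: ge_inf; [exists 0 | exists v].
move=> h; rewrite -[_ +i* 0]/(a%:C) -rmorphD/= lecR (le_trans (ltW rlt))//.
by rewrite lerD2r.
Qed.

(** Near-minimizers of the distance to [x] form a Cauchy sequence by the parallelogram law. Their
    limit is a minimizer, and minimality forces orthogonality. *)
Lemma orthogonal_projection H (L : set H) x : L 0 ->
    (forall a u v, L u -> L v -> L (a *: u + v)) -> closed L ->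
  exists2 p, L p & forall u, L u -> inner (x - p) u = 0.
Proof.
move=> L0 LP clL.
pose d m : R[i] := m.+1%:R^-1.
have d0 m : 0 < d m by rewrite invr_gt0 ltr0n.
have dge0 m : 0 <= d m by exact: ltW.
have dle N m : (N <= m)%N -> d m <= d N.
  by move=> Nm; rewrite lef_pV2 ?posrE ?ltr0n// ler_nat.
(* The error is a square so that the Cauchy estimate, after a square root, is linear in [d N]. *)
have /choice[u uP] : forall m, exists u, L u /\
    forall v, L v -> `|x - u| ^+ 2 <= `|x - v| ^+ 2 + d m ^+ 2.
  move=> m; have [|u Lu uP] := @almost_nearest_point _ L x (d m ^+ 2) L0.
    by rewrite exprn_gt0.
  by exists u.
have uC N m k : (N <= m)%N -> (N <= k)%N -> `|u m - u k| <= d N *+ 2.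
  move=> Nm Nk.
  have [[Lm mP] [Lk kP]] := (uP m, uP k).
  (* The midpoint lies in [L], so both near-minimizers can be compared with it. *)
  pose w := 2^-1 *: (u m + u k).
  have Lw : L w.
    by rewrite -(addr0 w); apply: (LP) => //; rewrite -(scale1r (u m)); apply: (LP).
  have := parallelogram (x - u m) (x - u k).
  have -> : x - u m - (x - u k) = u k - u m by rewrite opprB addrC addrA subrK.
  move=> E.
  have {}E : `|u m - u k| ^+ 2 =
      (`|x - u m| ^+ 2 + `|x - u k| ^+ 2) *+ 2 - `|x - w| ^+ 2 *+ 4.
    apply/eqP; rewrite eq_sym subr_eq -E distrC; apply/eqP.
    congr (_ + _).
    have -> : (x - u m) + (x - u k) = 2 *: (x - w).
      rewrite scalerBr scalerA divff ?scale1r ?pnatr_eq0//.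
      by rewrite addrACA -opprD scaler_nat mulr2n.
    by rewrite normrZ exprMn normr_nat -natrX mulr_natl.
  apply: ler_of_sqr; rewrite ?normr_ge0 ?mulrn_wge0//.
  rewrite E lerBlDr.
  apply: (@le_trans _ _
      ((`|x - w| ^+ 2 + d N ^+ 2 + (`|x - w| ^+ 2 + d N ^+ 2)) *+ 2)).
    have dsq j : (N <= j)%N -> d j ^+ 2 <= d N ^+ 2.
      by move=> Nj; by rewrite ler_pXn2r ?nnegrE// dle.
    rewrite lerMn2r/= lerD//.
      by rewrite (le_trans (mP _ Lw))// lerD2l dsq.
    by rewrite (le_trans (kP _ Lw))// lerD2l dsq.
  by rewrite le_eqVlt; apply/orP; left; apply/eqP; ring.
have cu : cauchy (u @ \oo).
  apply/cauchy_exP => e e0.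
  have e20 : 0 < e / 2 by rewrite divr_gt0.
  have [N NP] := exists_natSinv_lt e20.
  exists (u N); exists N => // m /= Nm; rewrite -ball_normE /=.
  apply: (le_lt_trans (uC N N m _ _)) => //.
  by rewrite -mulr_natr -ltr_pdivlMr// NP.
have /cvg_ex[p up] : cvg (u @ \oo) by exact: cauchy_cvg.
have Lp : L p.
  apply: (closed_cvg L clL _ p up); apply: nearW => m.
  by have [] := uP m.
exists p => //.
have pmin v : L v -> `|x - p| <= `|x - v|.
  move=> Lv; apply/ler_addgt0Pr => e e0.
  have e20 : 0 < e / 2 by rewrite divr_gt0.
  have [N NP] := exists_natSinv_lt e20.
  move/cvgrPdist_lt : up => /(_ _ e20)[N' _ N'P].
  pose m := maxn N N'.
  have [_ mP] := uP m.
  have xm : `|x - u m| <= `|x - v| + d m.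
    apply: ler_of_sqr; rewrite ?normr_ge0 ?addr_ge0//.
    rewrite (le_trans (mP _ Lv))// sqrrD -addrA lerD2l lerDr mulrn_wge0//.
    by rewrite mulr_ge0.
  have -> : x - p = (x - u m) + (u m - p) by rewrite addrA subrK.
  rewrite (le_trans (ler_normD _ _))// (splitr e) addrA lerD//.
    by rewrite (le_trans xm)// lerD2l ltW// NP// leq_maxl.
  by rewrite distrC ltW// N'P//= leq_maxr.
move=> v Lv; set g := x - p; set c := inner g v.
have [v0|v0] := eqVneq v 0; first by rewrite /c v0 inner0r.
have nv : 0 < `|v| ^+ 2 by rewrite exprn_gt0// normr_gt0.
have v2 : `|v| != 0 by rewrite normr_eq0.
(* Moving [p] by the optimal multiple of [v] would lower the squared distance by [|c|^2 / |v|^2], so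
   minimality gives [c = 0]. *)
pose a := c / `|v| ^+ 2.
have ra : Num.conj a = Num.conj c / `|v| ^+ 2.
  by rewrite rmorphM/= fmorphV/= [X in _ / X = _]geC0_conj ?exprn_ge0.
have : `|g| ^+ 2 <= `|g - a *: v| ^+ 2.
  rewrite ler_pXn2r ?nnegrE// /g -addrA -opprD pmin//.
  by rewrite addrC; apply: (LP).
rewrite (normB2 g) innerZl innerZr normrZ exprMn (innerC v g) -/c -addrA lerDl.
have -> : `|a| ^+ 2 * `|v| ^+ 2 - (Num.conj a * c + a * Num.conj c) =
    - (`|c| ^+ 2 / `|v| ^+ 2).
  by rewrite !normCK ra /a; field.
rewrite oppr_ge0 pmulr_lle0 ?invr_gt0// => c0.
have : `|c| ^+ 2 == 0 by rewrite eq_le c0 exprn_ge0.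
by rewrite expf_eq0/= normr_eq0 => /eqP.
Qed.

End Projection.

Section LinearMaps.
Context {K : nzRingType} {U V : lmodType K} (A : U -> V).
Hypothesis lA : linear A.

Let Al : {linear U -> V} := HB.pack A (GRing.isLinear.Build K U V *:%R A lA).

Lemma lin0 : A 0 = 0. Proof. exact: (linear0 Al). Qed.
Lemma linD x y : A (x + y) = A x + A y. Proof. exact: (linearD Al). Qed.
Lemma linB x y : A (x - y) = A x - A y. Proof. exact: (linearB Al). Qed.
Lemma linZ a x : A (a *: x) = a *: A x. Proof. exact: (linearZZ Al). Qed.
Lemma lin_sum I (r : seq I) (P : pred I) (E : I -> U) :
  A (\sum_(i <- r | P i) E i) = \sum_(i <- r | P i) A (E i).
Proof. exact: (linear_sum Al). Qed.

End LinearMaps.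

(** * Riesz representation, adjoints and contractions *)

Section Adjoints.
Context {R : realType}.
Implicit Types H U V W : hilbertType R.

Lemma eq0_of_lt_all (a : R[i]) : 0 <= a -> (forall e, 0 < e -> a < e) -> a = 0.
Proof.
move=> a0 ae; apply/eqP; rewrite eq_le a0 andbT.
by apply/ler_addgt0Pr => e e0; rewrite add0r ltW// ae.
Qed.

Lemma closure_norm H (L : set H) x :
  closure L x <-> forall e, 0 < e -> exists2 u, L u & `|x - u| < e.
Proof.
split=> [cx e e0|h B /nbhs_ballP[e /= e0 eB]].
  by have [u [Lu]] := cx _ (nbhsx_ballx x e e0); rewrite -ball_normE; exists u.
have [u Lu xu] := h e e0.
by exists u; split => //; apply: eB; rewrite -ball_normE.
Qed.

Lemma bounded_operatorP U V (A : U -> V) : linear A ->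
  bounded_operator A <-> exists2 C, 0 < C & forall x, `|A x| <= C * `|x|.
Proof.
move=> lA.
pose Al : {linear U -> V} := HB.pack A (GRing.isLinear.Build R[i] U V *:%R A lA).
split=> [[_ cA]|[C C0 AC]].
  have /linear_boundedP/pinfty_ex_gt0[C C0 AC] : bounded_near Al (nbhs 0).
    by apply/linear_bounded_continuous.
  by exists C.
split=> //; apply: (@bounded_linear_continuous _ _ _ Al).
apply/linear_boundedP; near=> r => x; apply: (le_trans (AC x)).
by rewrite ler_wpM2r//; near: r; apply: nbhs_pinfty_ge; rewrite gtr0_real.
Unshelve. all: by end_near. Qed.

(** The codomain is general enough to cover both scalar functionals and operators. *)
Lemma closed_ker H (W : normedZmodType R[i]) (phi : H -> W) (C : R[i]) : 0 < C ->
    (forall x y, phi (x - y) = phi x - phi y) ->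
    (forall x, `|phi x| <= C * `|x|) ->
  closed [set x | phi x = 0].
Proof.
move=> C0 phiB phiC x /closure_norm cx /=.
apply/eqP; rewrite -normr_eq0; apply/eqP; apply: eq0_of_lt_all => // e e0.
have [|u /= u0 xu] := cx (e / C); first by rewrite divr_gt0.
have -> : phi x = phi (x - u) by rewrite phiB u0 subr0.
by rewrite (le_lt_trans (phiC _))// mulrC -ltr_pdivlMr.
Qed.

(** Take [e] orthogonal to the kernel with [phi e] nonzero. Then [x - (phi x / phi e) *: e] lies in
    the kernel, and its orthogonality to [e] can be solved for [phi x]. *)
Lemma riesz H (phi : H -> R[i]) (C : R[i]) : 0 < C ->
    (forall a x y, phi (a *: x + y) = a * phi x + phi y) ->
    (forall x, `|phi x| <= C * `|x|) ->
  exists y, forall x, phi x = inner x y.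
Proof.
move=> C0 phiP phiC.
have phi0 : phi 0 = 0 by have := phiP (-1) 0 0; rewrite scaler0 addr0 mulN1r addNr.
have phiD x y : phi (x + y) = phi x + phi y.
  by rewrite -[x]scale1r phiP mul1r scale1r.
have phiZ a x : phi (a *: x) = a * phi x.
  by rewrite -[_ *: _]addr0 phiP phi0 addr0.
have phiB x y : phi (x - y) = phi x - phi y.
  by rewrite phiD -scaleN1r phiZ mulN1r.
have [[x0 x0P]|] := pselect (exists x, phi x <> 0); last first.
  by move=> /forallNP h; exists 0 => x; rewrite inner0r; exact: contrapT (h x).
have [|a u v /= u0 v0||p /= p0 pP] :=
  @orthogonal_projection _ _ [set x | phi x = 0] x0.
- exact: phi0.
- by rewrite phiP u0 v0 mulr0 addr0.
- exact: (closed_ker C0 phiB phiC).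
pose e := x0 - p.
have phie : phi e = phi x0 by rewrite phiB p0 subr0.
have e0 : inner e e != 0.
  apply/eqP => /inner_eq0 h; apply: x0P.
  by rewrite -phie h phi0.
have pe : phi e != 0 by rewrite phie; exact/eqP.
exists (Num.conj (phi e / inner e e) *: e) => x.
have /pP : phi (x - (phi x / phi e) *: e) = 0.
  by rewrite phiB phiZ divfK// subrr.
rewrite -/e innerBr innerZr => /eqP; rewrite subr_eq0 => /eqP h.
rewrite innerZr conjCK (innerC x) h rmorphM/= conjCK -(innerC e).
by field; rewrite e0 pe.
Qed.

Lemma adjoint_unique U V (A : U -> V) x y :
  (forall u, inner (A u) y = inner u x) -> adjoint A y = x.
Proof.
move=> h; rewrite /adjoint; case: xgetP => [z _ /= zP|/(_ x)/(_ h)//].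
by apply: inner_ext => u; rewrite innerC -zP h -innerC.
Qed.

Lemma adjointP U V (A : U -> V) : bounded_operator A ->
  forall u y, inner (A u) y = inner u (adjoint A y).
Proof.
move=> bA u y; have [lA _] := bA.
have /(bounded_operatorP lA)[C C0 AC] := bA.
(* The [+ 1] keeps the bound positive when [y = 0]. *)
have [|||x xP] := @riesz _ (fun u => inner (A u) y) (C * (`|y| + 1)).
- by rewrite mulr_gt0// ltr_pwDr.
- by move=> a v w; rewrite lA innerDl innerZl.
- move=> v; rewrite (le_trans (cauchy_schwarz _ _))//.
  rewrite mulrAC ler_pM// ?normr_ge0//.
  by rewrite lerDl.
- by rewrite xP (adjoint_unique xP).
Qed.

Lemma adjointPr U V (A : U -> V) : bounded_operator A ->
  forall u y, inner y (A u) = inner (adjoint A y) u.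
Proof. by move=> bA u y; rewrite innerC adjointP// -innerC. Qed.

Lemma adjoint_linear U V (A : U -> V) : bounded_operator A -> linear (adjoint A).
Proof.
move=> bA a x y; apply: adjoint_unique => u.
by rewrite !(innerDr, innerZr) !adjointP.
Qed.

Definition contractive U V (A : U -> V) : Prop :=
  linear A /\ forall x, `|A x| <= `|x|.

Lemma isometry_contractive U V (A : U -> V) : is_isometry A -> contractive A.
Proof. by move=> [lA nA]; split=> // x; rewrite nA. Qed.

Lemma contractive_bounded U V (A : U -> V) : contractive A -> bounded_operator A.
Proof.
by move=> [lA nA]; apply/bounded_operatorP => //; exists 1 => // x; rewrite mul1r.
Qed.

(** Cauchy-Schwarz bounds [|adjoint A y|^2 = inner (A (adjoint A y)) y] by [|adjoint A y| * |y|];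
    divide by [|adjoint A y|]. *)
Lemma adjoint_contractive U V (A : U -> V) :
  contractive A -> contractive (adjoint A).
Proof.
move=> cA; have bA := contractive_bounded cA.
split=> [|y]; first exact: adjoint_linear.
have [->|Ay] := eqVneq (adjoint A y) 0; first by rewrite normr0.
have n0 : 0 < `|adjoint A y| by rewrite normr_gt0.
rewrite -(ler_pM2l n0) -expr2 -inner_norm -adjointP//.
have := cauchy_schwarz (A (adjoint A y)) y.
rewrite adjointP// inner_norm [`|_ ^+ 2|]ger0_norm ?exprn_ge0// => /le_trans; apply.
by rewrite ler_wpM2r//; case: cA.
Qed.

(** Expanding [|adjoint A (A x) - x|^2] leaves [|adjoint A (A x)|^2 - |x|^2], which is at most 0.
    Asking for norm preservation at one vector only lets this serve partial isometries too. *)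
Lemma adjointK_norm U V (A : U -> V) x :
  contractive A -> `|A x| = `|x| -> adjoint A (A x) = x.
Proof.
move=> cA nx; have bA := contractive_bounded cA.
have : `|adjoint A (A x) - x| ^+ 2 <= 0.
  rewrite normB2 -adjointP// -adjointPr// inner_norm nx opprD addrA addrK.
  rewrite subr_le0 ler_pXn2r ?nnegrE//.
  by rewrite -nx; case: (adjoint_contractive cA) => _; exact.
move=> h; have : `|adjoint A (A x) - x| ^+ 2 == 0 by rewrite eq_le h exprn_ge0.
by rewrite expf_eq0/= normr_eq0 subr_eq0 => /eqP.
Qed.

Lemma isometry_inner U V (A : U -> V) x y :
  is_isometry A -> inner (A x) (A y) = inner x y.
Proof.
move=> iA; have cA := isometry_contractive iA.
by rewrite adjointP ?adjointK_norm//; [case: iA | exact: contractive_bounded].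
Qed.

End Adjoints.

(** * Extending maps from total families *)

Section Extension.
Context {R : realType}.
Implicit Types H U V W : hilbertType R.

Definition total_family (X : Type) H (a : X -> H) : Prop :=
  forall u, (forall x, inner u (a x) = 0) -> u = 0.

(** Coefficients and indices form a list independent of the family, so that one list can be
    evaluated in two spaces. *)
Definition lincomb (X : Type) H (a : X -> H) (s : seq (R[i] * X)) : H :=
  \sum_(p <- s) p.1 *: a p.2.

Lemma lincombP (X : Type) (c : R[i]) (s t : seq (R[i] * X)) : exists r,
  forall H (a : X -> H), lincomb a r = c *: lincomb a s + lincomb a t.
Proof.
exists ([seq (c * p.1, p.2) | p <- s] ++ t) => H a.
rewrite /lincomb big_cat big_map scaler_sumr; congr (_ + _).
by apply: eq_bigr => p _; rewrite scalerA.
Qed.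

(** The difference between [u] and its projection onto the closed span is orthogonal to every [a x],
    hence zero. *)
Lemma lincomb_dense (X : Type) H (a : X -> H) : total_family a ->
  forall u (e : R[i]), 0 < e -> exists s, `|u - lincomb a s| < e.
Proof.
move=> ta u.
pose L := closure (range (lincomb a)).
have aL s : L (lincomb a s) by apply: subset_closure; exists s.
have [|c x y /closure_norm Lx /closure_norm Ly||p Lp pP] :=
  @orthogonal_projection _ _ L u.
- by have := aL [::]; rewrite /lincomb big_nil.
- apply/closure_norm => e e0.
  have c0 : 0 < `|c| + 1 by rewrite ltr_pwDr.
  have [|_ [s _ <-] xs] := Lx (e / 2 / (`|c| + 1)); first by rewrite !divr_gt0.
  have [|_ [t _ <-] yt] := Ly (e / 2); first by rewrite divr_gt0.
  have [r rP] := lincombP c s t.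
  exists (lincomb a r); first by exists r.
  rewrite rP opprD addrACA -scalerBr (splitr e).
  rewrite (le_lt_trans (ler_normD _ _))// ler_ltD// normrZ.
  have := ltW xs; rewrite ler_pdivlMr// mulrC => /(le_trans _); apply.
  by rewrite ler_wpM2r// lerDl.
- exact: closed_closure.
have up : u = p.
  apply/eqP; rewrite -subr_eq0; apply/eqP/ta => x; apply: pP.
  by have := aL [:: (1, x)]; rewrite /lincomb big_seq1 scale1r.
move: Lp; rewrite -up => /closure_norm Lu e e0.
by have [_ [s _ <-] us] := Lu e e0; exists s.
Qed.

Lemma contractive_extension (X : Type) U V (a : X -> U) (b : X -> V) :
    total_family a -> (forall s, `|lincomb b s| <= `|lincomb a s|) ->
  exists2 N, contractive N & forall x, N (a x) = b x.
Proof.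
move=> ta ba.
(* the closure of the graph {(sum c a x, sum c b x)} *)
pose rel u v := forall e : R[i], 0 < e ->
  exists s, `|u - lincomb a s| < e /\ `|v - lincomb b s| < e.
have relP c u v u' v' : rel u v -> rel u' v' -> rel (c *: u + u') (c *: v + v').
  move=> uv uv' e e0.
  have c0 : 0 < `|c| + 1 by rewrite ltr_pwDr.
  have e1 : 0 < e / 2 / (`|c| + 1) by rewrite !divr_gt0.
  have e2 : 0 < e / 2 by rewrite divr_gt0.
  have [s [us vs]] := uv _ e1.
  have [t [ut vt]] := uv' _ e2.
  have [r rP] := lincombP c s t.
  have key W (x x' y y' : W) :
      `|x - y| < e / 2 / (`|c| + 1) -> `|x' - y'| < e / 2 ->
      `|c *: x + x' - (c *: y + y')| < e.
    move=> h h'.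
    rewrite opprD addrACA -scalerBr (splitr e).
    rewrite (le_lt_trans (ler_normD _ _))// ler_ltD// normrZ.
    have := ltW h; rewrite ler_pdivlMr// mulrC => /(le_trans _); apply.
    by rewrite ler_wpM2r// lerDl.
  by exists r; rewrite !rP; split; exact: key.
(* The bound passes to the closure; with [relP] it makes the relation single-valued. *)
have reln u v : rel u v -> `|v| <= `|u|.
  move=> uv; apply/ler_addgt0Pr => e e0.
  have e2 : 0 < e / 2 by rewrite divr_gt0.
  have [s [us vs]] := uv _ e2.
  have -> : v = (v - lincomb b s) + lincomb b s by rewrite subrK.
  rewrite (le_trans (ler_normD _ _))// (splitr e) addrA [leLHS]addrC.
  apply: lerD; last exact: ltW.
  rewrite (le_trans (ba s))// -[lincomb a s](subrK u).
  by rewrite (le_trans (ler_normD _ _))// [leLHS]addrC lerD2l distrC ltW.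
(* By [ba], the combinations of [b] built on Cauchy combinations of [a] are Cauchy as well; their
   limit is the value at [u]. *)
have rel_ex u : exists v, rel u v.
  have /choice[s sP] : forall m, exists s, `|u - lincomb a s| < m.+1%:R^-1.
    by move=> m; apply: lincomb_dense; rewrite // invr_gt0 ltr0n.
  have close e : 0 < e -> exists N, forall m, (N <= m)%N ->
      `|u - lincomb a (s m)| < e.
    move=> /exists_natSinv_lt[N NP]; exists N => m /NP.
    by apply: lt_trans; exact: sP.
  pose w m := lincomb b (s m).
  have cw : cauchy (w @ \oo).
    apply/cauchy_exP => e e0.
    have e2 : 0 < e / 2 by rewrite divr_gt0.
    have [N NP] := close _ e2.
    exists (w N); exists N => // m /= Nm; rewrite -ball_normE /=.
    have [r rP] := lincombP (-1) (s m) (s N).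
    have -> : w N - w m = lincomb b r by rewrite rP scaleN1r addrC.
    rewrite (le_lt_trans (ba r))// rP scaleN1r.
    have -> : - lincomb a (s m) + lincomb a (s N) =
        (u - lincomb a (s m)) - (u - lincomb a (s N)).
      by rewrite opprB [RHS]addrC subrKA addrC.
    by rewrite (le_lt_trans (ler_normB _ _))// (splitr e) ltrD// NP.
  have /cvg_ex[v wv] : cvg (w @ \oo) by exact: cauchy_cvg.
  exists v => e e0; have [N NP] := close _ e0.
  move/cvgrPdist_lt : wv => /(_ _ e0)[N' _ N'P].
  exists (s (maxn N N')); split; first by rewrite NP// leq_maxl.
  by apply: N'P; rewrite /= leq_maxr.
have rel_uniq u v v' : rel u v -> rel u v' -> v = v'.
  move=> uv uv'; apply/eqP; rewrite eq_sym -subr_eq0 -normr_le0.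
  have := reln _ _ (relP (-1) _ _ _ _ uv uv').
  by rewrite !scaleN1r addNr normr0 addrC.
have /choice[N NP] := rel_ex.
exists N.
  split=> [c u v|u]; last exact: reln.
  by apply: (rel_uniq (c *: u + v)) => //; exact: relP.
move=> x; apply: (rel_uniq (a x)) => // e e0.
by exists [:: (1, x)]; rewrite /lincomb !big_seq1 !scale1r !subrr !normr0.
Qed.

Lemma inner_lincomb (X : Type) H (a : X -> H) s t :
  inner (lincomb a s) (lincomb a t) =
  \sum_(p <- s) \sum_(q <- t) p.1 * Num.conj q.1 * inner (a p.2) (a q.2).
Proof.
rewrite inner_suml; apply: eq_bigr => p _.
rewrite inner_sumr; apply: eq_bigr => q _.
by rewrite innerZl innerZr mulrA.
Qed.

(** Equal Gram matrices give a contractive extension [N]. Testing against the total family shows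
    that [adjoint N] inverts [N], first on the family and then everywhere. *)
Lemma isometric_extension (X : Type) U V (a : X -> U) (b : X -> V) :
    total_family a -> (forall x y, inner (b x) (b y) = inner (a x) (a y)) ->
  exists2 N, is_isometry N & forall x, N (a x) = b x.
Proof.
move=> ta ba.
have [s|N cN NE] := @contractive_extension _ _ _ a b ta.
  apply: ler_of_sqr => //; rewrite -!inner_norm !inner_lincomb.
  under eq_bigr do under eq_bigr do rewrite ba.
  by [].
exists N => //; split=> [|u]; first by case: cN.
have bN := contractive_bounded cN.
have NN x : adjoint N (N (a x)) = a x.
  apply/eqP; rewrite -subr_eq0; apply/eqP/ta => y.
  by rewrite innerBl -adjointPr// !NE ba subrr.
have {}NN : adjoint N (N u) = u.
  apply/eqP; rewrite -subr_eq0; apply/eqP/ta => y.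
  by rewrite innerBl -adjointPr// adjointP// NN subrr.
apply/eqP; rewrite eq_le (cN.2 u)/=; apply: ler_of_sqr => //.
by rewrite -!inner_norm adjointP// NN.
Qed.

End Extension.

(** * The Drury-Arveson space *)

Section ReproducingKernel.
Context {R : realType} {X : Type} {k : X -> X -> R[i]} {E : hilbertType R}.
Variable F : rkhs k E.

Lemma rkhs_eval_linear z : linear (fun f : F => rkhs_eval f z).
Proof. by move=> a f g; exact: rkhs_evalP. Qed.

Lemma rkhs_ext (f g : F) : rkhs_eval f =1 rkhs_eval g -> f = g.
Proof. by move=> fg; apply: (@rkhs_eval_inj _ _ _ _ F); exact/funext. Qed.

Definition kernel_fun w eta : F := projT1 (cid (rkhs_kernel F w eta)).

Lemma kernel_funE w eta z : rkhs_eval (kernel_fun w eta) z = k z w *: eta.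
Proof. by rewrite /kernel_fun; case: cid => K []. Qed.

Lemma inner_kernel_fun f w eta :
  inner f (kernel_fun w eta) = inner (rkhs_eval f w) eta.
Proof. by rewrite /kernel_fun; case: cid => K [_] /=. Qed.

Lemma total_kernel_fun : total_family (fun p => kernel_fun p.1 p.2).
Proof.
move=> f f0; apply: rkhs_ext => z.
rewrite (lin0 (rkhs_eval_linear z)); apply: inner_ext => eta.
by rewrite inner0l -inner_kernel_fun (f0 (z, eta)).
Qed.

Lemma multiplicationE (phi : X -> R[i]) f (g : F) :
  (forall z, rkhs_eval g z = phi z *: rkhs_eval f z) -> multiplication F phi f = g.
Proof.
move=> gE; rewrite /multiplication; case: xgetP => [h _ /= hE|/(_ g)/(_ gE)//].
by apply: rkhs_ext => z; rewrite hE gE.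
Qed.

End ReproducingKernel.

Section DruryArvesonSpace.
Context {R : realType} {n : nat} {E : hilbertType R}.
Variable F : drury_arveson n E.
Local Notation ball := (@unit_ball R n).

Lemma coordinate_lt1 (w : ball) : \sum_(i < n) `|coordinate i w| ^+ 2 < 1.
Proof. exact: (valP w). Qed.

(** If the sum were 1, then [2 |z_i| |w_i| <= |z_i|^2 + |w_i|^2] summed over [i] would give
    [2 < 2]. *)
Lemma drury_arveson_denom_neq0 (z w : ball) :
  1 - \sum_(i < n) coordinate i z * Num.conj (coordinate i w) != 0.
Proof.
rewrite subr_eq0; apply/eqP => e1.
have : (1 : R[i]) *+ 2 < 1 *+ 2.
  rewrite -[X in X *+ 2 < _](@normr1 R[i]) [X in `|X|]e1.
  apply: (@le_lt_trans _ _
      (\sum_(i < n) (`|coordinate i z| ^+ 2 + `|coordinate i w| ^+ 2))).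
    rewrite -mulr_natr -ler_pdivlMr// mulr_suml (le_trans (ler_norm_sum _ _ _))//.
    apply: ler_sum => i _; rewrite normrM norm_conjC ler_pdivlMr// mulr_natr.
    rewrite -subr_ge0.
    have -> : `|coordinate i z| ^+ 2 + `|coordinate i w| ^+ 2 -
        `|coordinate i z| * `|coordinate i w| *+ 2 =
        (`|coordinate i z| - `|coordinate i w|) ^+ 2 by ring.
    by rewrite real_exprn_even_ge0// realB.
  by rewrite big_split/= mulr2n ltrD// coordinate_lt1.
by rewrite ltxx.
Qed.

Definition unit_ball0 : ball.
Proof.
exists 0; rewrite big1 ?ltr01// => i _.
by rewrite mxE normr0 expr0n.
Defined.

Lemma coordinate_center i : coordinate i unit_ball0 = 0.
Proof. by rewrite /coordinate /= mxE. Qed.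

Lemma kernel_fun_center eta z : rkhs_eval (kernel_fun F unit_ball0 eta) z = eta.
Proof.
rewrite kernel_funE /drury_arveson_kernel big1 ?subr0 ?invr1 ?scale1r// => i _.
by rewrite coordinate_center conjC0 mulr0.
Qed.

Lemma inner_kernel_fun2 (w v : ball) eta zeta :
  inner (kernel_fun F w eta) (kernel_fun F v zeta) =
  drury_arveson_kernel v w * inner eta zeta.
Proof. by rewrite inner_kernel_fun kernel_funE innerZl. Qed.

(* The Gram matrix of the family [conj w_i K_w eta] is dominated by that of
   [K_w eta], because [(1 - sum_i z_i conj w_i) k(z, w) = 1]. *)
Lemma backward_shift i : exists2 N : F -> F, contractive N &
  forall p, N (kernel_fun F p.1 p.2) =
    Num.conj (coordinate i p.1) *: kernel_fun F p.1 p.2.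
Proof.
apply: contractive_extension; first exact: total_kernel_fun.
move=> s; apply: ler_of_sqr => //.
pose b j (p : ball * E) := Num.conj (coordinate j p.1) *: kernel_fun F p.1 p.2.
pose c (p : ball * E) := p.2.
(* The difference of the two sides of the domination is itself a sum of Gram matrices: those of the
   other [b j] and that of the vectors [eta] in [E]. *)
have gram p q : inner (kernel_fun F p.1 p.2) (kernel_fun F q.1 q.2) =
    \sum_(j < n) inner (b j p) (b j q) + inner (c p) (c q).
  rewrite /b /c; under eq_bigr do
    rewrite innerZl innerZr conjCK inner_kernel_fun2 mulrA (mulrC (Num.conj _)).
  rewrite -mulr_suml inner_kernel_fun2 /drury_arveson_kernel mulrA.
  have := drury_arveson_denom_neq0 q.1 p.1; set t := \sum_(_ < n) _ => t1.
  by field.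
have -> : `|lincomb (fun p => kernel_fun F p.1 p.2) s| ^+ 2 =
    \sum_(j < n) `|lincomb (b j) s| ^+ 2 + `|lincomb c s| ^+ 2.
  rewrite -!inner_norm !inner_lincomb.
  under [in RHS]eq_bigr do rewrite -inner_norm inner_lincomb.
  rewrite [X in _ = X + _]exchange_big/= -big_split; apply: eq_bigr => p _.
  rewrite [X in _ = X + _]exchange_big/= -big_split; apply: eq_bigr => q _.
  by rewrite gram /= mulrDr mulr_sumr.
by rewrite (bigD1 i)//= -addrA lerDl addr_ge0 ?sumr_ge0// => *; rewrite exprn_ge0.
Qed.

(** Testing against kernel functions shows that the adjoint of the backward shift multiplies by
    [z_i]. Hence [z_i] is a multiplier, and the default value in [multiplication] never occurs for
    it. *)
Lemma Mz_adjoint i : exists2 N : F -> F, contractive N & Mz F i = adjoint N /\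
  forall f z, rkhs_eval (adjoint N f) z = coordinate i z *: rkhs_eval f z.
Proof.
have [N cN NE] := backward_shift i.
have ME f z : rkhs_eval (adjoint N f) z = coordinate i z *: rkhs_eval f z.
  apply: inner_ext => eta.
  rewrite -inner_kernel_fun -adjointPr; last exact: contractive_bounded.
  by rewrite (NE (z, eta)) innerZr conjCK inner_kernel_fun innerZl.
by exists N => //; split=> //; apply/funext => f; exact: multiplicationE.
Qed.

Lemma Mz_eval i f z : rkhs_eval (Mz F i f) z = coordinate i z *: rkhs_eval f z.
Proof. by have [N _ [-> ->]] := Mz_adjoint i. Qed.

Lemma Mz_bounded i : bounded_operator (Mz F i).
Proof.
have [N cN [-> _]] := Mz_adjoint i.
exact/contractive_bounded/adjoint_contractive.
Qed.

(** This is [k(z, w) = (sum_i z_i conj w_i) k(z, w) + 1], read as an identity of functions of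
    [z]. *)
Lemma kernel_fun_decomposition (w : ball) eta : kernel_fun F w eta =
  \sum_(i < n) Num.conj (coordinate i w) *: Mz F i (kernel_fun F w eta) +
  kernel_fun F unit_ball0 eta.
Proof.
apply: rkhs_ext => z; have lz := @rkhs_eval_linear _ _ _ _ F z.
rewrite (linD lz) (lin_sum lz) kernel_fun_center.
under eq_bigr do rewrite (linZ lz) Mz_eval kernel_funE !scalerA.
rewrite kernel_funE -scaler_suml -[eta in X in _ + X]scale1r -scalerDl.
congr (_ *: _).
under eq_bigr do rewrite mulrA (mulrC (Num.conj _)).
rewrite -mulr_suml /drury_arveson_kernel.
have := drury_arveson_denom_neq0 z w; set t := \sum_(_ < n) _ => t1.
by field.
Qed.

(** Pairing [f] with the decomposition of the kernel function solves Gleason's problem for [f] at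
    the origin. *)
Lemma eval_decomposition (f : F) (w : ball) : rkhs_eval f w =
  \sum_(i < n) coordinate i w *: rkhs_eval (adjoint (Mz F i) f) w +
  rkhs_eval f unit_ball0.
Proof.
apply: inner_ext => eta; rewrite -inner_kernel_fun {1}kernel_fun_decomposition.
rewrite innerDr inner_kernel_fun innerDl inner_sumr inner_suml; congr (_ + _).
apply: eq_bigr => i _; rewrite innerZr conjCK innerZl adjointPr.
  by rewrite inner_kernel_fun.
exact: Mz_bounded.
Qed.

(** By [eval_decomposition], [f] is the sum of the [M_i M_i^* f] and the constant function [f(0)];
    pair this with [g]. *)
Lemma inner_decomposition (f g : F) : inner f g =
  \sum_(i < n) inner (adjoint (Mz F i) f) (adjoint (Mz F i) g) +
  inner (rkhs_eval f unit_ball0) (rkhs_eval g unit_ball0).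
Proof.
have {1}-> : f = \sum_(i < n) Mz F i (adjoint (Mz F i) f) +
    kernel_fun F unit_ball0 (rkhs_eval f unit_ball0).
  apply: rkhs_ext => z; have lz := @rkhs_eval_linear _ _ _ _ F z.
  rewrite (linD lz) (lin_sum lz) kernel_fun_center [LHS]eval_decomposition.
  by congr (_ + _); apply: eq_bigr => i _; rewrite Mz_eval.
rewrite innerDl inner_suml; congr (_ + _).
  by apply: eq_bigr => i _; rewrite adjointP//; exact: Mz_bounded.
by rewrite innerC inner_kernel_fun -innerC.
Qed.

End DruryArvesonSpace.

(** * Minimal dilations *)

Section MinimalDilation.
Context {R : realType}.

(** For [u] in [L] closer to [f] than [|f|], [|f|^2 = inner (f - u) f] would be smaller than
    [|f|^2]. *)
Lemma closure_orthogonal_eq0 (H : hilbertType R) (L : set H) f :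
  (forall u, L u -> inner u f = 0) -> closure L f -> f = 0.
Proof.
move=> Lf /closure_norm fL.
have [//|f0] := eqVneq f 0; have nf : 0 < `|f| by rewrite normr_gt0.
have [u Lu fu] := fL _ nf; exfalso.
have := cauchy_schwarz (f - u) f.
rewrite innerBl (Lf _ Lu) subr0 inner_norm ger0_norm ?exprn_ge0//.
by rewrite expr2 ler_pM2r// => /le_lt_trans/(_ fu); rewrite ltxx.
Qed.

Lemma exp_lt_eventually (r e : R[i]) : 0 <= r -> r < 1 -> 0 < e ->
  exists m, r ^+ m < e.
Proof.
case: r => r r'; case: e => e e'.
rewrite lecE !ltcE /= => /andP[/eqP-> r0] /andP[_ r1] /andP[/eqP-> e0].
have /cvgr0Pnorm_lt/(_ _ e0)[m _ mP] : r ^+ m @[m --> \oo] --> 0.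
  by apply: cvg_expr; rewrite ger0_norm.
exists m; have := mP m (leqnn m); rewrite /= ger0_norm ?exprn_ge0// -ltcR rmorphXn.
by [].
Qed.

(** Iterating the invariance gives [|delta x| <= C r^m |x|] for every [m]. *)
Lemma strict_contraction_invariant (H : hilbertType R) (A : H -> H)
    (delta : H -> R[i]) (r C : R[i]) : 0 <= r -> r < 1 -> 0 <= C ->
    (forall x, `|A x| <= r * `|x|) -> (forall x, `|delta x| <= C * `|x|) ->
    (forall x, delta x = delta (A x)) ->
  forall x, delta x = 0.
Proof.
move=> r0 r1 C0 Ar dC dA x.
have iter_le m : `|delta x| <= C * (r ^+ m * `|x|).
  have -> : delta x = delta (iter m A x).
    by elim: m => // m -> /=; rewrite dA.
  rewrite (le_trans (dC _))// ler_wpM2l//.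
  elim: m => [|m IH] /=; first by rewrite expr0 mul1r.
  by rewrite (le_trans (Ar _))// exprS -mulrA ler_wpM2l.
apply/eqP; rewrite -normr_eq0; apply/eqP/eq0_of_lt_all => // e e0.
have c0 : 0 < C * `|x| + 1 by rewrite ltr_pwDr// mulr_ge0.
have [m mP] := @exp_lt_eventually r (e / (C * `|x| + 1)) r0 r1 (divr_gt0 e0 c0).
rewrite (le_lt_trans (iter_le m))// mulrCA.
move: mP; rewrite ltr_pdivlMr// => /(le_lt_trans _); apply.
by rewrite ler_wpM2l ?exprn_ge0// lerDl.
Qed.

Context {n : nat} {K E : hilbertType R} (F : drury_arveson n E).

Section OneDilation.
Variables (B : 'I_n -> K -> K) (Gamma : K -> F).
Hypothesis Gamma_isometry : is_isometry Gamma.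
Hypothesis Gamma_intertwines :
  forall i x, adjoint (Mz F i) (Gamma x) = Gamma (B i x).

Let D x := rkhs_eval (Gamma x) unit_ball0.

(** Here [B i] stands for the adjoint of [R_i]. The right-hand side does not mention [Gamma], so the
    defect maps of any two dilations have the same Gram matrix. *)
Lemma dilation_defect x y :
  inner (D x) (D y) = inner x y - \sum_(i < n) inner (B i x) (B i y).
Proof.
rewrite -(isometry_inner x y Gamma_isometry) inner_decomposition.
under eq_bigr do rewrite !Gamma_intertwines (isometry_inner _ _ Gamma_isometry).
by rewrite addrC addKr.
Qed.

Lemma dilation_row_contraction x : \sum_(i < n) `|B i x| ^+ 2 <= `|x| ^+ 2.
Proof.
rewrite -subr_ge0 -inner_norm; under eq_bigr do rewrite -inner_norm.
by rewrite -dilation_defect inner_norm exprn_ge0.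
Qed.

(** [eval_decomposition] is carried through [Gamma]; iterating the resulting recursion recovers
    [Gamma] from [D]. *)
Lemma dilation_eval_resolvent x (w : unit_ball n) : rkhs_eval (Gamma x) w =
  rkhs_eval (Gamma (\sum_(i < n) coordinate i w *: B i x)) w + D x.
Proof.
have [lG _] := Gamma_isometry.
have le := @rkhs_eval_linear _ _ _ _ F w.
rewrite eval_decomposition (lin_sum lG) (lin_sum le); congr (_ + _).
by apply: eq_bigr => i _; rewrite Gamma_intertwines (linZ lG) (linZ le).
Qed.

(* A vector [eta] orthogonal to the range of D yields a constant function
   orthogonal to all [z^k G h].  Should [z^k G h] be undefined, its junk value 0
   is harmless here, so no multiplier property of monomials is required. *)
Lemma minimal_dilation_total : is_minimal Gamma -> total_family D.
Proof.
rewrite /is_minimal; set L := linear_span _ => min eta eta0.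
have [lG _] := Gamma_isometry.
suff f0 : kernel_fun F unit_ball0 eta = 0.
  rewrite -[eta](kernel_fun_center F eta unit_ball0) f0.
  exact: (lin0 (@rkhs_eval_linear _ _ _ _ F _)).
apply: (@closure_orthogonal_eq0 _ L); last by rewrite min.
move=> _ [m [c [v [vP ->]]]]; rewrite inner_suml big1// => i _.
have [k [h ->]] := vP i.
rewrite innerZl inner_kernel_fun /Mmonomial /multiplication.
case: xgetP => [g _ /= ->|_].
  by rewrite innerZl innerC eta0 conjC0 !mulr0.
by rewrite (lin0 (@rkhs_eval_linear _ _ _ _ F _)) inner0l mulr0.
Qed.

End OneDilation.

(** With [s] the sum of the [|w_i|^2], the inequality [2ab <= a^2 + b^2] yields the factor
    [(s + 1) / 2]. It is still below 1 and avoids the square root of [s]. *)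
Lemma coordinate_contraction (B : 'I_n -> K -> K) (w : unit_ball n) :
    (forall x, \sum_(i < n) `|B i x| ^+ 2 <= `|x| ^+ 2) ->
  forall x, `|\sum_(i < n) coordinate i w *: B i x| <=
    (\sum_(i < n) `|coordinate i w| ^+ 2 + 1) / 2 * `|x|.
Proof.
move=> Bc x.
have [->|x0] := eqVneq x 0.
  rewrite normr0 mulr0 normr_le0 big1// => i _.
  (* [B] is just a family of maps, so [B i 0 = 0] is read off from the bound at 0. *)
  suff -> : B i 0 = 0 by rewrite scaler0.
  have : `|B i 0| ^+ 2 <= 0.
    have := Bc 0; rewrite (bigD1 i)//= normr0 expr0n/=; apply: le_trans.
    by rewrite lerDl sumr_ge0// => *; rewrite exprn_ge0.
  rewrite real_exprn_even_le0 ?normr_real//= => /eqP.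
  by move/normr0_eq0.
have nx : 0 < `|x| by rewrite normr_gt0.
rewrite -(ler_pM2r nx) -[leRHS]mulrA -expr2.
apply: (@le_trans _ _ (\sum_(i < n) (`|coordinate i w| * `|x|) * `|B i x|)).
  rewrite mulrC (le_trans (ler_wpM2l _ (ler_norm_sum _ _ _)))// mulr_sumr.
  by apply: ler_sum => i _; rewrite normrZ mulrA (mulrC `|x|).
apply: (@le_trans _ _ (\sum_(i < n)
    (`|coordinate i w| ^+ 2 * `|x| ^+ 2 + `|B i x| ^+ 2) / 2)).
  apply: ler_sum => i _; rewrite ler_pdivlMr// -subr_ge0.
  set p := `|coordinate i w|; set q := `|x|; set t := `|B i x|.
  have -> : p ^+ 2 * q ^+ 2 + t ^+ 2 - p * q * t * 2 = (p * q - t) ^+ 2 by ring.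
  rewrite real_exprn_even_ge0//; apply: realB; last exact: normr_real.
  by apply: realM; exact: normr_real.
rewrite -mulr_suml big_split/= -mulr_suml mulrAC ler_wpM2r// mulrDl lerD2l mul1r.
exact: Bc.
Qed.

End MinimalDilation.

Lemma minimal_dilation_factor (R : realType) (n : nat) (K E Et : hilbertType R)
    (F : drury_arveson n E) (Ft : drury_arveson n Et)
    (B : 'I_n -> K -> K) (Gamma : K -> F) (Gammat : K -> Ft) :
    is_isometry Gamma -> is_isometry Gammat ->
    (forall i x, adjoint (Mz F i) (Gamma x) = Gamma (B i x)) ->
    (forall i x, adjoint (Mz Ft i) (Gammat x) = Gammat (B i x)) ->
    is_minimal Gamma ->
  exists2 V : E -> Et, is_isometry V &
    forall x w, rkhs_eval (Gammat x) w = V (rkhs_eval (Gamma x) w).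
Proof.
move=> iG iGt GB GtB min.
have [V iV VD] := isometric_extension (minimal_dilation_total iG min)
  (fun x y => etrans (dilation_defect iGt GtB x y)
    (esym (dilation_defect iG GB x y))).
exists V => // x w; apply: inner_ext => zeta; apply/eqP.
rewrite -subr_eq0; apply/eqP.
have [[lG nG] [lGt nGt] [lV _]] := And3 iG iGt iV.
have bV := contractive_bounded (isometry_contractive iV).
pose r : R[i] := (\sum_(i < n) `|coordinate i w| ^+ 2 + 1) / 2.
(* In the difference of the two recursions the terms in [D] cancel because [V] carries one defect
   map to the other. The constant comes from Cauchy-Schwarz against the kernel functions. *)
apply: (@strict_contraction_invariant _ _
  (fun x => \sum_(i < n) coordinate i w *: B i x)
  (fun x => inner (rkhs_eval (Gammat x) w) zeta -
    inner (V (rkhs_eval (Gamma x) w)) zeta)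
  r (`|kernel_fun Ft w zeta| + `|kernel_fun F w (adjoint V zeta)|)).
- by rewrite divr_ge0// addr_ge0// sumr_ge0// => i _; rewrite exprn_ge0.
- by rewrite ltr_pdivrMr// mul1r ltrD2r coordinate_lt1.
- by rewrite addr_ge0.
- exact: coordinate_contraction (dilation_row_contraction iG GB).
- move=> {}x; rewrite adjointP// -!inner_kernel_fun (le_trans (ler_normB _ _))//.
  rewrite mulrDl lerD// mulrC (le_trans (cauchy_schwarz _ _))//.
    by rewrite nGt.
  by rewrite nG.
- move=> {}x; rewrite (dilation_eval_resolvent iGt GtB x w).
  rewrite (dilation_eval_resolvent iG GB x w) (linD lV) -VD !innerDl.
  by rewrite opprD addrACA subrr addr0.
Qed.

(** * The operator [I (x) V^*] and its adjoint *)

Section IdTensor.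
Context {R : realType} {n : nat} {E Et : hilbertType R}.
Variables (F : drury_arveson n E) (Ft : drury_arveson n Et) (V : E -> Et).
Hypothesis V_isometry : is_isometry V.

Let V_bounded : bounded_operator V.
Proof. exact/contractive_bounded/isometry_contractive. Qed.

(** To rule out the default value, a witness is built: [K_w eta -> K_w (V eta)] extends to an
    isometry, and its adjoint has the required action on elementary tensors. *)
Lemma id_tensor_adjoint_spec :
  bounded_operator (id_tensor Ft F (adjoint V)) /\
  forall phi eta f, is_elementary_tensor Ft phi eta f ->
    is_elementary_tensor F phi (adjoint V eta) (id_tensor Ft F (adjoint V) f).
Proof.
rewrite /id_tensor; case: xgetP => [W _ //|].
have [|U iU UE] := @isometric_extension _ _ _ _
  (fun p => kernel_fun F p.1 p.2) (fun p => kernel_fun Ft p.1 (V p.2))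
  (@total_kernel_fun _ _ _ _ F).
  by move=> p q; rewrite !inner_kernel_fun2 isometry_inner.
have cU := isometry_contractive iU; have bU := contractive_bounded cU.
move=> /(_ (adjoint U))[]; split.
  exact/contractive_bounded/adjoint_contractive.
move=> phi eta f fE z; apply: inner_ext => zeta.
rewrite -inner_kernel_fun -adjointPr// (UE (z, zeta)) inner_kernel_fun fE.
by rewrite !innerZl adjointPr.
Qed.

(** A kernel function is the elementary tensor of [k(., w)] and [zeta]. *)
Lemma id_tensor_adjoint_kernel w zeta :
  id_tensor Ft F (adjoint V) (kernel_fun Ft w zeta) =
  kernel_fun F w (adjoint V zeta).
Proof.
have [_ WE] := id_tensor_adjoint_spec.
apply: rkhs_ext => z; rewrite kernel_funE.
by apply: (WE (fun z => drury_arveson_kernel z w)) => v; rewrite kernel_funE.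
Qed.

Lemma eval_adjoint_id_tensor f w :
  rkhs_eval (adjoint (id_tensor Ft F (adjoint V)) f) w = V (rkhs_eval f w).
Proof.
have [bW _] := id_tensor_adjoint_spec.
apply: inner_ext => zeta.
rewrite -inner_kernel_fun -adjointPr// id_tensor_adjoint_kernel inner_kernel_fun.
by rewrite adjointP.
Qed.

End IdTensor.

(** * Partial isometries and their adjoints *)

Section PartialIsometry.
Context {R : realType} {U H : hilbertType R} (A : U -> H).
Hypothesis A_partial_isometry : partial_isometry A.

(** The vector [p] is the component of [u] orthogonal to the kernel of [A]. *)
Lemma partial_isometry_initial u :
  exists p, [/\ A p = A u, `|A p| = `|p| & `|p| <= `|u|].
Proof.
have [bA nA] := A_partial_isometry; have [lA _] := bA.
have [C C0 AC] := (bounded_operatorP lA).1 bA.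
have [|a x y /= x0 y0||q /= q0 qP] :=
  @orthogonal_projection _ _ [set x | A x = 0] u.
- exact: (lin0 lA).
- by rewrite lA x0 y0 scaler0 addr0.
- exact: (closed_ker C0 (linB lA) AC).
have Ap : A (u - q) = A u by rewrite (linB lA) q0 subr0.
exists (u - q); split=> //; first by apply: nA => y /qP.
have [->|p0] := eqVneq (u - q) 0; first by rewrite normr0.
have np : 0 < `|u - q| by rewrite normr_gt0.
rewrite -(ler_pM2r np) (le_trans _ (cauchy_schwarz _ _))//.
have -> : inner u (u - q) = inner (u - q) (u - q).
  by rewrite [RHS]innerBl [inner q _]innerC qP// conjC0 subr0.
by rewrite inner_norm ger0_norm ?exprn_ge0// expr2.
Qed.

Lemma partial_isometry_contractive : contractive A.
Proof.
split=> [|u]; first by case: A_partial_isometry => -[].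
by have [p [<- ->]] := partial_isometry_initial u.
Qed.

(** Replacing [u] by its initial component [p] gives [adjoint A (A p) = p]. Thus the adjoint is
    isometric on the range of [A]. *)
Lemma partial_isometry_adjoint_norm u : `|adjoint A (A u)| = `|A u|.
Proof.
have [p [<- np _]] := partial_isometry_initial u.
by rewrite adjointK_norm//; exact: partial_isometry_contractive.
Qed.

End PartialIsometry.

(** * Restriction to an invariant subspace, and the factorization *)

Section Restriction.
Context {R : realType} {H : hilbertType R} {n : nat}.
Variables (T : 'I_n -> H -> H) (S : closed_subspace H).
Hypothesis S_invariant : invariant_subspace T S.

Lemma inclusion_mem (x : subspace_type S) : (S : set H) (inclusion S x).
Proof. by have := valP x; rewrite unfold_in inE. Qed.

(** Invariance keeps [T i x] in [S], so [insubd] does not fall back to 0. *)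
Lemma inclusion_restriction i x :
  inclusion S (restriction T S i x) = T i (inclusion S x).
Proof.
rewrite /restriction /inclusion val_insubd unfold_in mem_set//.
exact: (@S_invariant i _ (ex_intro2 _ _ _ (inclusion_mem x) erefl)).
Qed.

Lemma restriction_bounded i :
  bounded_operator (T i) -> bounded_operator (restriction T S i).
Proof.
move=> bT; have [lT _] := bT.
have [C C0 TC] := (bounded_operatorP lT).1 bT.
apply/bounded_operatorP => [a x y|].
  apply: val_inj; rewrite -[LHS]/(inclusion S _) inclusion_restriction.
  rewrite -[RHS]/(a *: inclusion S _ + inclusion S _) !inclusion_restriction.
  exact: lT.
exists C => // x; rewrite -[leLHS]/(`|inclusion S _|) inclusion_restriction.
exact: TC.
Qed.

End Restriction.

Theorem theorem4p3 (R : realType) (n : nat) (H E Et : hilbertType R)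
  (T : 'I_n -> H -> H)
  (T_bounded : forall i, bounded_operator (T i))
  (T_commuting : commuting T)
  (T_contractive : row_contraction T)
  (T_pure : pure T)
  (S : closed_subspace H) (S_invariant : invariant_subspace T S)
  (F : drury_arveson n E) (Pi : F -> H)
  (Pi_canonical : canonical_representation T S Pi)
  (Ft : drury_arveson n Et) (Pit : Ft -> H)
  (Pit_partial_isometry : partial_isometry Pit)
  (Pit_range : (S : set H) = range Pit)
  (Pit_intertwining : forall i, Pit \o Mz Ft i = T i \o Pit) :
  exists V : E -> Et,
    is_isometry V /\ Pit = Pi \o id_tensor Ft F (adjoint V).
Proof.
have [PiS [[iPiS PiSB] min ->]] := Pi_canonical.
have cPit := partial_isometry_contractive Pit_partial_isometry.
have bPit := contractive_bounded cPit.
have Pit_mem f : (S : set H) (Pit f) by rewrite Pit_range; exists f.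
pose toS f : subspace_type S := Sub (Pit f) (mem_set (Pit_mem f)).
(* The second dilation of the restricted tuple, isometric because every vector of [S] is some
   [Pit f]. *)
pose PitS (x : subspace_type S) := adjoint Pit (inclusion S x).
have iPitS : is_isometry PitS.
  split=> [a x y|x]; first exact: (adjoint_linear bPit).
  have := inclusion_mem x; rewrite Pit_range => -[f _ fx].
  by rewrite /PitS -fx partial_isometry_adjoint_norm// fx.
have PitSB i x : adjoint (Mz Ft i) (PitS x) = PitS (adjoint (restriction T S i) x).
  apply: adjoint_unique => f; rewrite -!adjointP//.
  have -> : Pit (Mz Ft i f) = T i (Pit f).
    by have /(congr1 (@^~ f)) := Pit_intertwining i.
  rewrite -[Pit f]/(inclusion S (toS f)) -inclusion_restriction//.
  rewrite -[LHS]/(inner (restriction T S i (toS f)) x) adjointP//.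
  exact: restriction_bounded.
have [V iV VE] := minimal_dilation_factor iPiS iPitS PiSB PitSB min.
exists V; split=> //; apply/funext => f /=.
rewrite -[Pit f]/(inclusion S (toS f)); congr (inclusion S _).
(* Pairing with [x] in [S] and moving all operators across turns the goal into
   [adjoint W (PiS x) = PitS x], with [W] the tensor operator; this is checked pointwise by [VE]. *)
apply: inner_ext => x.
rewrite -adjointPr; last exact/contractive_bounded/isometry_contractive.
rewrite -[LHS]/(inner (Pit f) (inclusion S x)) adjointP//.
have [bW _] := id_tensor_adjoint_spec F Ft iV.
rewrite [RHS]adjointP//; congr (inner f _); apply: rkhs_ext => w.
by rewrite eval_adjoint_id_tensor// -VE.
Qed.
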